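(* Let $G$ be a countable discrete group, equipped with a bounded geometry left-invariant metric $d$. Then $G$ admits a canonical atlas which is free and globally controlled. In particular, $\kappa_G(R)=1$ for all $R>0$.
   Context: Let $(X,d)$ be a metric space. A partial bijection of $X$ is a subset $s\subseteq X\times X$ on which both coordinate projections to $X$ are injective; it is viewed as a partially defined injection, writing $x=s(y)$ (or $x = sy$) if $(x,y)\in s$. A partial translation of $X$ is a partial bijection $t$ such that $d(x,y)$ is bounded for $(x,y)\in t$. If $\mathcal{T}$ is a collection of (pairwise) disjoint partial translations of $X$, a partial bijection $\sigma$ is a partial cotranslation for $\mathcal{T}$ if for all $t\in\mathcal{T}$ and $(x,y)\in t$ such that $\sigma$ is defined on both $x$ and $y$, we have $(\sigma x,\sigma y)\in t$. An atlas on $X$ is a family $\mathcal{A}=\{(\mathcal{T}_R,\Sigma_R)\mid R>0\}$ where, for each $R>0$, $\mathcal{T}_R$ is a finite set of disjoint partial translations of $X$ and $\Sigma_R$ is a collection of partial cotranslations for $\mathcal{T}_R$ such that: (1) the union of the $t\in\mathcal{T}_R$ contains all $(x,y)\in X\times X$ with $d(x,y)<R$; (2) there exists $k$ such that for each $x,x'\in X$ there are at most $k$ elements $\sigma\in\Sigma_R$ with $\sigma x=x'$; (3) for each $t\in\mathcal{T}_R$ and all $(x,y),(x',y')\in t$ there exists $\sigma\in\Sigma_R$ with $\sigma x=x'$ and $\sigma y=y'$. Let $k_{\mathcal{A}}(R)$ be the smallest $k$ for which (2) holds. The atlas is free if $k_{\mathcal{A}}(R)=1$ for all $R>0$. It is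 globally controlled if for all $R>0$ and $x,y\in X$ the cotranslation orbit $\{(x',y') : \exists\,\sigma\in\Sigma_R,\ \sigma x=x',\ \sigma y=y'\}$ is a partial translation. For $X$ a uniformly discrete bounded geometry metric space, $\kappa_X(R)$ is the minimum of $k_{\mathcal{A}}(R)$ over all atlases $\mathcal{A}$ on $X$. (Uniformly discrete: distances between distinct points are bounded below by a positive constant; bounded geometry: for each $R>0$ the cardinalities of $R$-balls are uniformly bounded.) The canonical atlas on $G$ is $\{(\mathcal{T}_R,\Sigma_R)\mid R>0\}$ with $\mathcal{T}_R=\{t_g : g\in G,\ d(e,g)<R\}$, where $t_g=\{(x,xg): x\in G\}$, and $\Sigma_R=\{\sigma_h: h\in G\}$, where $\sigma_h(x)=hx$. *)

(* Defs.v *)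
From HB Require Import structures.
From mathcomp Require Import all_boot all_order all_algebra.
From mathcomp Require Import interval_inference.
From mathcomp Require Import boolp classical_sets functions cardinality reals.
From mathcomp Require Import topology.

Set Implicit Arguments.
Unset Strict Implicit.
Unset Printing Implicit Defensive.

Local Open Scope classical_set_scope.
Local Open Scope card_scope.
Local Open Scope ring_scope.

(* The topology of a metric group is the one induced by the distance; no
   compatibility between the distance and the group law is built in. *)
#[short(type="metricGroupType")]
HB.structure Definition MetricGroup (R : numDomainType) :=
  {G of Metric R G & Group G}.

(* A partial bijection s is its graph, with the convention that s (x, y)
   means x = s y: the value comes first, the argument second. *)
Definition partial_bijection (X : Type) (s : set (X * X)) : Prop :=
  set_inj s fst /\ set_inj s snd.

Definition partial_translation (R : realType) (X : metricType R)
    (t : set (X * X)) : Prop :=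
  partial_bijection t /\ exists M : R, forall x y, t (x, y) -> mdist x y <= M.

Definition partial_cotranslation (X : Type) (T : set (set (X * X)))
    (s : set (X * X)) : Prop :=
  partial_bijection s /\
  forall t, T t -> forall x y x' y',
    t (x, y) -> s (x', x) -> s (y', y) -> t (x', y').

Record atlas_data (R : realType) (X : Type) := AtlasData {
  translations : {posnum R} -> set (set (X * X));
  cotranslations : {posnum R} -> set (set (X * X)) }.

Definition multiplicity_bound (R : realType) (X : Type) (A : atlas_data R X)
    (r : {posnum R}) (k : nat) : Prop :=
  forall x x' : X, [set s | cotranslations A r s /\ s (x', x)] #<= `I_k.

Definition is_atlas (R : realType) (X : metricType R) (A : atlas_data R X) :
    Prop :=
  forall r : {posnum R},
  [/\ finite_set (translations A r),
      trivIset (translations A r) id &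
      forall t, translations A r t -> partial_translation t] /\
  (forall s, cotranslations A r s ->
     partial_cotranslation (translations A r) s) /\
  [/\ forall x y : X, mdist x y < r%:num ->
        exists2 t, translations A r t & t (x, y),
      exists k, multiplicity_bound A r k &
      forall t, translations A r t -> forall x y x' y',
        t (x, y) -> t (x', y') ->
        exists2 s, cotranslations A r s & s (x', x) /\ s (y', y)].

(* Junk value 0 on the empty set. *)
Definition nat_min (P : set nat) : nat :=
  xget 0%N [set k | P k /\ forall j, P j -> (k <= j)%N].

Definition atlas_multiplicity (R : realType) (X : Type) (A : atlas_data R X)
    (r : {posnum R}) : nat :=
  nat_min [set k | multiplicity_bound A r k].

Definition free_atlas (R : realType) (X : Type) (A : atlas_data R X) : Prop :=
  forall r, atlas_multiplicity A r = 1%N.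

Definition cotranslation_orbit (R : realType) (X : Type) (A : atlas_data R X)
    (r : {posnum R}) (x y : X) : set (X * X) :=
  [set p | exists2 s, cotranslations A r s & s (p.1, x) /\ s (p.2, y)].

Definition globally_controlled (R : realType) (X : metricType R)
    (A : atlas_data R X) : Prop :=
  forall r x y, partial_translation (cotranslation_orbit A r x y).

Definition bounded_geometry (R : realType) (X : metricType R) : Prop :=
  forall r : {posnum R}, exists n, forall x : X, ball x r%:num #<= `I_n.

(* Meant for X uniformly discrete of bounded geometry. *)
Definition kappa (R : realType) (X : metricType R) (r : {posnum R}) : nat :=
  nat_min [set atlas_multiplicity A r | A in @is_atlas R X].

Definition left_invariant (R : realType) (G : metricGroupType R) : Prop :=
  forall g x y : G, mdist (g * x)%g (g * y)%g = mdist x y.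

Definition canonical_atlas (R : realType) (G : metricGroupType R) :
    atlas_data R G :=
  {| translations := fun r =>
       [set range (fun x : G => (x, x * g)%g)
         | g in [set g : G | mdist (1%g : G) g < r%:num]];
     cotranslations := fun _ =>
       [set range (fun x : G => (h * x, x)%g) | h in [set: G]] |}.

(* Main.v *)
Require Import Defs.
From mathcomp Require Import all_boot all_order all_algebra.
From mathcomp Require Import interval_inference.
From mathcomp Require Import boolp classical_sets functions cardinality reals.
From mathcomp Require Import topology.

(** Left and right multiplications commute.  The right translations
    [t_g = {(x, xg)}] partition [G * G] into the fibres of
    [(x, y) |-> x^-1 y], and [d(x, xg) = d(1, g)] by left invariance: hence
    [t_g] is a partial translation, the [t_g] with [d(1, g) < r] cover all
    pairs at distance less than [r], and they are as few as the points of the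
    ball of radius [r] at [1].  The left translations are cotranslations
    because [(hx)^-1 (hy) = x^-1 y].  Left multiplication is simply
    transitive on [G], so that the only left translation taking [x] to [x'] is
    that by [x' x^-1], and it also takes [xg] to [x'g]: this gives transitivity
    on each [t_g] and multiplicity at most one
    ([canonical_multiplicity_bound1]).  A cotranslation orbit
    [{(hx, hy) : h}] is at the constant distance [d(x, y)], again by left
    invariance.

    That the multiplicity is not zero holds for every atlas on a nonempty space
    ([multiplicity_bound_gt0]): the pair [(x, x)] lies in some translation, so
    transitivity produces a cotranslation fixing [x].  The same bound, applied
    to an arbitrary atlas, makes one the minimum defining [kappa]. *)

Set Implicit Arguments.
Unset Strict Implicit.
Unset Printing Implicit Defensive.

Local Open Scope classical_set_scope.
Local Open Scope card_scope.
Local Open Scope ring_scope.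

Lemma nat_min_eq (P : set nat) (k : nat) :
  P k -> (forall j, P j -> (k <= j)%N) -> nat_min P = k.
Proof.
move=> Pk kP; apply: xget_unique => [//|j [Pj jP]].
by apply/eqP; rewrite eqn_leq jP // kP.
Qed.

Lemma nat_min_mem (P : set nat) : P !=set0 -> P (nat_min P).
Proof.
case=> n Pn.
have exP : exists k, `[< P k >] by exists n; apply/asboolP.
case: (ex_minnP exP) => k /asboolP Pk kP.
by rewrite (@nat_min_eq P k) // => j Pj; apply: kP; apply/asboolP.
Qed.

(** The covering condition puts [(x, x)] in some translation, and transitivity
    from that pair to itself yields a cotranslation fixing [x]. *)
Lemma multiplicity_bound_gt0 (R : realType) (X : metricType R)
    (A : atlas_data R X) (r : {posnum R}) (k : nat) (x : X) :
  is_atlas A -> multiplicity_bound A r k -> (0 < k)%N.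
Proof.
move=> /(_ r)[_ [_ [cover _ transitive]]].
have [|t At txx] := cover x x; first by rewrite mdistxx gt0.
have [s As [sxx _]] := transitive t At x x x x txx txx.
case: k => // /(_ x x).
by rewrite II0 => /card_le0P/seteqP[/(_ s)]/(_ (conj As sxx)).
Qed.

(** Some multiplicity bound exists, so the minimum is attained and is not the
    default value [0]. *)
Lemma atlas_multiplicity_gt0 (R : realType) (X : metricType R)
    (A : atlas_data R X) (r : {posnum R}) (x : X) :
  is_atlas A -> (0 < atlas_multiplicity A r)%N.
Proof.
move=> atlasA; apply: (multiplicity_bound_gt0 x atlasA (r := r)).
by apply: nat_min_mem; have [_ [_ []]] := atlasA r.
Qed.

Section CanonicalAtlas.
Variables (R : realType) (G : metricGroupType R).
Implicit Types (r : {posnum R}) (x y g h : G).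

Lemma mem_right_translation g x y :
  range (fun z : G => (z, z * g)%g) (x, y) <-> y = (x * g)%g.
Proof. by split=> [[z _ [<- <-]]|->] //; exists x. Qed.

Lemma mem_left_translation h x y :
  range (fun z : G => (h * z, z)%g) (y, x) <-> y = (h * x)%g.
Proof. by split=> [[z _ [<- <-]]|->] //; exists x. Qed.

Lemma canonical_cotranslationP r x x' (s : set (G * G)) :
  cotranslations (canonical_atlas G) r s /\ s (x', x) <->
  s = range (fun z : G => (x' / x * z, z)%g).
Proof.
split=> [[[h _ <-]] /mem_left_translation ->|->]; first by rewrite mulgK.
by split; [exists (x' / x)%g|apply/mem_left_translation; rewrite mulgVK].
Qed.

Lemma canonical_multiplicity_bound1 r :
  multiplicity_bound (canonical_atlas G) r 1.
Proof.
move=> x x'; set sigma := range (fun z : G => (x' / x * z, z)%g).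
rewrite -(card_le_eqr (@card_set1 _ sigma)); apply: subset_card_le => s.
by move=> /canonical_cotranslationP ->.
Qed.

Hypothesis linv : left_invariant G.

Lemma mdist_mulr x g : mdist x (x * g)%g = mdist 1%g g.
Proof. by rewrite -[RHS](linv x) mulg1. Qed.

Lemma right_translation_partial_translation g :
  partial_translation (range (fun x : G => (x, x * g)%g)).
Proof.
split.
  split=> -[x1 y1] [x2 y2] /set_mem/mem_right_translation ->
    /set_mem/mem_right_translation -> /=; first by move=> ->.
  by move=> /mulIg ->.
by exists (mdist 1%g g) => x y /mem_right_translation ->; rewrite mdist_mulr.
Qed.

Lemma left_translation_partial_bijection h :
  partial_bijection (range (fun x : G => (h * x, x)%g)).
Proof.
by split=> -[x1 y1] [x2 y2] /set_mem/mem_left_translation ->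
  /set_mem/mem_left_translation -> /= => [/mulgI|] ->.
Qed.

Lemma canonical_is_atlas : bounded_geometry G -> is_atlas (canonical_atlas G).
Proof.
move=> bg r; split; [split|split; [|split]].
- apply: finite_image; have [n /(_ 1%g) le_n] := bg r.
  by apply/finite_set_leP; exists n; rewrite ballEmdist in le_n.
- move=> _ _ [g _ <-] [g' _ <-] [[x y]].
  by move=> [/mem_right_translation -> /mem_right_translation /mulgI ->].
- by move=> _ [g _ <-]; apply: right_translation_partial_translation.
- move=> _ [h _ <-]; split; first exact: left_translation_partial_bijection.
  move=> _ [g _ <-] x y x' y' /mem_right_translation ->.
  move=> /mem_left_translation -> /mem_left_translation ->.
  by apply/mem_right_translation; rewrite mulgA.
- move=> x y xy_lt; exists (range (fun z : G => (z, z * (x^-1 * y))%g)).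
    exists (x^-1 * y)%g => //=.
    by rewrite -(mdist_mulr x) mulgA mulgV mul1g.
  by apply/mem_right_translation; rewrite mulgA mulgV mul1g.
- by exists 1%N; apply: canonical_multiplicity_bound1.
- move=> _ [g _ <-] x y x' y' /mem_right_translation ->
    /mem_right_translation ->.
  exists (range (fun z : G => (x' / x * z, z)%g)); first by exists (x' / x)%g.
  by split; apply/mem_left_translation; rewrite ?mulgA mulgVK.
Qed.

Lemma canonical_free : bounded_geometry G -> free_atlas (canonical_atlas G).
Proof.
move=> bg r; apply: nat_min_eq; first exact: canonical_multiplicity_bound1.
by move=> j; apply: (multiplicity_bound_gt0 (1%g : G) (canonical_is_atlas bg)).
Qed.

(** The orbit of [(x, y)] is parametrized by [h |-> (hx, hy)]; each coordinate
    determines [h] by cancellation on the right. *)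
Lemma canonical_globally_controlled : globally_controlled (canonical_atlas G).
Proof.
move=> r x y; split.
  split=> -[x1 y1] [x2 y2] /set_mem[_ [h _ <-]
    [/mem_left_translation/= -> /mem_left_translation/= ->]]
    /set_mem[_ [h' _ <-]
    [/mem_left_translation/= -> /mem_left_translation/= ->]] /=;
  by move=> /mulIg ->.
exists (mdist x y) => x' y' [_ [h _ <-]].
by move=> [/mem_left_translation/= -> /mem_left_translation/= ->]; rewrite linv.
Qed.

End CanonicalAtlas.

Theorem proposition15 (R : realType) (G : metricGroupType R)
    (countableG : countable [set: G]%classic)
    (bg : bounded_geometry G) (linv : left_invariant G) :
  [/\ is_atlas (canonical_atlas G),
      free_atlas (canonical_atlas G),
      globally_controlled (canonical_atlas G) &
      forall r : {posnum R}%R, kappa G r = 1%N].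
Proof.
have atlasG := canonical_is_atlas linv bg.
have freeG := canonical_free linv bg.
split=> [//|//||r]; first exact: canonical_globally_controlled.
apply: nat_min_eq; first by exists (canonical_atlas G).
by move=> _ [A atlasA <-]; apply: (atlas_multiplicity_gt0 r (1%g : G)).
Qed.
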